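(* Let $n>d\geq 1$ be integers. There are positive constants $C_3, C_5$ depending only on $d$ such that the following holds. Assume that $f\colon\{-1,1\}^n\to\{-1,1\}$ satisfies, for some $\alpha\in(0,C_3)$, $$\mathrm{Inf}_I(f)\leq \alpha\left(\frac{\ln n}{n}\right)^{d+1}\quad\text{for all } I\subseteq[n] \text{ with } |I|=d+1,$$ and that for some $l\in\{1,\dots,d\}$ we have $|\hat f(I)|\leq 2^{-d}$ for all $I\subseteq[n]$ with $|I|\leq l-1$. Then there exists a function $g\colon\{-1,1\}^n\to\{-1,1\}$ of degree at most $d$ such that $$\|f-g\|_2^2\leq C_5\,\alpha\left(\frac{\ln n}{n}\right)^l .$$
   Context: $[n]=\{1,\dots,n\}$. For $J \subseteq [n]$ let $\chi_J(x) = \prod_{j\in J} x_j$ (with $\chi_\varnothing = 1$); every $f\colon\{-1,1\}^n\to\mathbb{R}$ has a unique expansion $f=\sum_{J\subseteq [n]} \hat f(J)\chi_J$, where $\hat f(J) = \mathbb{E}[f\chi_J]$ under the uniform measure on $\{-1,1\}^n$; $\|f\|_2^2=\mathbb{E}[f^2]$ under the same measure. The T-influence is $\mathrm{Inf}_I(f)=\sum_{J\supseteq I}\hat f(J)^2$ (sum over $J\subseteq[n]$). A function $g$ has degree at most $d$ (is ''of $d$-degree'') if $\hat g(J)=0$ for all $J$ with $|J|>d$. ''Depending only on $d$'' means the constants do not depend on $n$, $f$, $\alpha$ or $l$. *)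

(* Defs.v *)
From mathcomp Require Import all_boot all_order all_algebra.
From mathcomp Require Import reals exp.

Set Implicit Arguments.
Unset Strict Implicit.
Unset Printing Implicit Defensive.

Import Order.TTheory GRing.Theory Num.Theory.
Local Open Scope ring_scope.

(* The discrete cube {-1,1}^n: the bit [x j] encodes the sign x_j = (-1)^(x j),
   so that [false] stands for 1 and [true] for -1. *)
Definition cube (n : nat) : finType := {ffun 'I_n -> bool}.

Definition coordinate (R : realType) (n : nat) (x : cube n) (j : 'I_n) : R :=
  (-1) ^+ (x j : bool).

Definition expectation (R : realType) (n : nat) (f : cube n -> R) : R :=
  (\sum_(x : cube n) f x) / #|cube n|%:R.

Definition chi (R : realType) (n : nat) (J : {set 'I_n}) (x : cube n) : R :=
  \prod_(j in J) coordinate R x j.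

Definition fourier (R : realType) (n : nat) (f : cube n -> R)
    (J : {set 'I_n}) : R :=
  expectation (fun x => f x * chi R J x).

Definition sqnorm2 (R : realType) (n : nat) (f : cube n -> R) : R :=
  expectation (fun x => f x ^+ 2).

Definition Tinfluence (R : realType) (n : nat) (I : {set 'I_n})
    (f : cube n -> R) : R :=
  \sum_(J : {set 'I_n} | I \subset J) fourier f J ^+ 2.

Definition degree_at_most (R : realType) (n d : nat) (g : cube n -> R) : Prop :=
  forall J : {set 'I_n}, (d < #|J|)%N -> fourier g J = 0.

Definition sign_valued (R : realType) (n : nat) (f : cube n -> R) : Prop :=
  forall x, f x = -1 \/ f x = 1.

(* Main.v *)
Require Import Defs.
From mathcomp Require Import all_boot all_order all_algebra.
From mathcomp Require Import reals sequences exp.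
From mathcomp Require Import zify ring lra.

(** Write [delta = ln n / n], and call constant what depends on [d] only.

    The first step bounds the Fourier weight of [f] above degree [d]. The discrete
    derivatives of [f] along sets of size [d + 1] take values in a lattice of
    bounded denominator, so that hypercontractivity ([bonami], [noise_gap])
    applies to them with a gain of a square root, as in the theorem of Kahn,
    Kalai and Linial. Summed over the sets of size [d + 1] that contain a fixed
    set [U] of size at most [d], this gives ([upper_weight])
    [\sum_(J | U \subset J, #|J| > d) fourier f J ^ 2 <= C alpha delta ^ #|U|].

    Applied to singletons, this bound together with hypercontractivity shows that
    the influence of a coordinate is either above a constant threshold or
    [O(alpha delta)] ([influence_dichotomy]). Boundedly many coordinates are of
    the first kind ([card_influential]), and all but [O(alpha)] of the Fourier
    weight of [f] lies on their subsets ([weight_off_influential]). Rounding the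
    average of [f] over the other coordinates gives a sign-valued [g] that
    depends on boundedly many coordinates, with [f - g] of squared norm
    [O(alpha)] ([exists_sign_junta]). The Fourier coefficients of [g] have a
    bounded denominator, hence those above degree [d], which are small, vanish.
    Then all coefficients of [g] are multiples of [2 ^ (1 - d)]
    ([sign_degree_fourier_granular]), and the hypothesis on the low coefficients
    of [f] makes those of [g] below level [l] vanish.

    The last step ([distance_bootstrap]) improves [O(alpha)] to
    [O(alpha delta ^ l)]. Let [h = f - g] and [q] its squared norm. Since
    [q = - 2 E(h g)], the number [q] is controlled by the coefficients of [h] at the
    frequencies [U] of [g], which have sizes between [l] and [d]. Averaging
    [h * chi U] over the coordinates of [g] and using that the result takes values
    in a lattice, these are controlled by the squared coefficients of [h] at
    the supersets of [U]. Those above degree [d] are coefficients of [f] and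
    contribute [O(alpha delta ^ l)] by the first step; those of degree at most [d]
    contribute [O(q ^ (3/2))] by hypercontractivity. As [q] is small, the
    latter term is absorbed. *)

Set Implicit Arguments.
Unset Strict Implicit.
Unset Printing Implicit Defensive.

Import Order.TTheory GRing.Theory Num.Theory.
Local Open Scope ring_scope.

(** * Expectation on the cube *)

Section Expectation.
Variables (R : realType) (n : nat).
Implicit Types (F G : cube n -> R).

Lemma card_cube_gt0 : 0 < #|cube n|%:R :> R.
Proof. by rewrite ltr0n card_ffun card_bool expn_gt0. Qed.

Lemma expectation_ext F G : F =1 G -> expectation F = expectation G.
Proof. by move=> FG; congr (_ / _); apply: eq_bigr => x _; apply: FG. Qed.

Lemma expectationD F G :
  expectation (fun x => F x + G x) = expectation F + expectation G.
Proof. by rewrite /expectation big_split mulrDl. Qed.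

Lemma expectationZ (a : R) F : expectation (fun x => a * F x) = a * expectation F.
Proof. by rewrite /expectation -mulr_sumr mulrA. Qed.

Lemma expectation_sum (T : finType) (P : pred T) (F : T -> cube n -> R) :
  expectation (fun x => \sum_(i | P i) F i x) =
  \sum_(i | P i) expectation (F i).
Proof. by rewrite /expectation exchange_big mulr_suml. Qed.

Lemma expectation_cst (a : R) : expectation (fun _ : cube n => a) = a.
Proof.
rewrite /expectation sumr_const -[_ *+ _]mulr_natr.
by apply: mulfK; rewrite gt_eqF ?card_cube_gt0.
Qed.

Lemma ler_expectation F G :
  (forall x, F x <= G x) -> expectation F <= expectation G.
Proof.
move=> FG; apply: ler_wpM2r; first by rewrite invr_ge0 ltW ?card_cube_gt0.
by apply: ler_sum.
Qed.

Lemma expectation_ge0 F : (forall x, 0 <= F x) -> 0 <= expectation F.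
Proof. by move=> F0; rewrite -(expectation_cst 0); apply: ler_expectation. Qed.

Lemma ler_norm_expectation F :
  `|expectation F| <= expectation (fun x => `|F x|).
Proof.
have c0 : 0 <= #|cube n|%:R^-1 :> R by rewrite invr_ge0 ltW ?card_cube_gt0.
by rewrite /expectation normrM (ger0_norm c0) ler_wpM2r // ler_norm_sum.
Qed.

Lemma expectation_Cauchy_Schwarz F G :
  expectation (fun x => F x * G x) ^+ 2 <=
  expectation (fun x => F x ^+ 2) * expectation (fun x => G x ^+ 2).
Proof.
(* Lagrange's identity, in the form of a double expectation *)
have : 0 <= expectation (fun x => expectation (fun y =>
    (F x * G y - F y * G x) ^+ 2)).
  by apply: expectation_ge0 => x; apply: expectation_ge0 => y; apply: sqr_ge0.
rewrite (expectation_ext (G := fun x =>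
   expectation (fun x => G x ^+ 2) * F x ^+ 2 +
   (expectation (fun x => F x ^+ 2) * G x ^+ 2 +
   (- 2 * expectation (fun x => F x * G x)) * (F x * G x)))).
  by rewrite !expectationD !expectationZ; lra.
move=> x; rewrite (expectation_ext (G := fun y =>
   F x ^+ 2 * G y ^+ 2 + (G x ^+ 2 * F y ^+ 2 +
   (- 2 * (F x * G x)) * (F y * G y)))) => [|y]; last by ring.
by rewrite !expectationD !expectationZ; ring.
Qed.

End Expectation.

(** * Fourier expansion *)

Section Fourier.
Variables (R : realType) (n : nat).
Implicit Types (F G : cube n -> R) (x y : cube n) (I J S T U : {set 'I_n}).

(** The point [x] with the signs of the coordinates in [T] changed. *)
Definition flip T x : cube n := [ffun j => x j (+) (j \in T)].

Lemma flipK T : involutive (flip T).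
Proof. by move=> x; apply/ffunP => j; rewrite !ffunE -addbA addbb addbF. Qed.

Lemma expectation_flip T F :
  expectation (fun x => F (flip T x)) = expectation F.
Proof.
rewrite /expectation [in RHS](reindex_inj (inv_inj (flipK T))) //.
Qed.

Lemma chi0 x : chi R set0 x = 1.
Proof. by rewrite /chi big_set0. Qed.

Lemma chi_sign J x : exists b : bool, chi R J x = (-1) ^+ b.
Proof.
apply: (big_ind (fun a : R => exists b : bool, a = (-1) ^+ b)).
- by exists false.
- by move=> _ _ [a ->] [b ->]; exists (a (+) b); rewrite signr_addb.
- by move=> j _; exists (x j).
Qed.

Lemma chi_all_ones J : chi R J [ffun => false] = 1.
Proof. by rewrite /chi big1 // => j _; rewrite /coordinate ffunE. Qed.

Lemma chiU I J x : [disjoint I & J] ->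
  chi R (I :|: J) x = chi R I x * chi R J x.
Proof.
by move=> dIJ; rewrite /chi -bigU //; apply: eq_bigl => j; rewrite !inE.
Qed.

Lemma chi_flip T J x :
  chi R J (flip T x) = chi R J x * \prod_(j in T) (-1) ^+ (j \in J).
Proof.
have -> : \prod_(j in T) (-1) ^+ (j \in J) =
          \prod_(j in J) (-1) ^+ (j \in T) :> R.
  rewrite [LHS]big_mkcond [RHS]big_mkcond; apply: eq_bigr => j _.
  by case: (j \in T); case: (j \in J); rewrite ?expr0.
by rewrite -big_split; apply: eq_bigr => j _; rewrite /coordinate ffunE signr_addb.
Qed.

Lemma chi_flip_disjoint T J x : [disjoint T & J] ->
  chi R J (flip T x) = chi R J x.
Proof.
move=> dTJ; rewrite chi_flip big1 ?mulr1 // => j jT.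
by rewrite (disjointFr dTJ jT).
Qed.

Lemma chi_flip1 i J x : i \in J -> chi R J (flip [set i] x) = - chi R J x.
Proof. by move=> iJ; rewrite chi_flip big_set1 iJ expr1 mulrN1. Qed.

Lemma expectation_odd i F : (forall x, F (flip [set i] x) = - F x) ->
  expectation F = 0.
Proof.
move=> oddF; have := expectation_flip [set i] F.
rewrite (expectation_ext (G := fun x => -1 * F x)) => [|x]; last first.
  by rewrite oddF mulN1r.
by rewrite expectationZ; lra.
Qed.

Lemma sum_subsets_prod S (c : 'I_n -> R) :
  \sum_(T : {set 'I_n} | T \subset S) \prod_(j in T) c j =
  \prod_(j in S) (1 + c j).
Proof.
rewrite [RHS]big_mkcond /=.
rewrite (eq_bigr (fun j => (if j \in S then c j else 0) + 1)); last first.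
  by move=> j _; case: ifP; rewrite ?add0r // addrC.
rewrite bigA_distr [LHS]big_mkcond /=; apply: eq_bigr => T _.
case: ifPn => [sTS|/subsetPn[j jT jS]].
  rewrite [LHS]big_mkcond; apply: eq_bigr => j _.
  by case: ifP => // /(subsetP sTS) ->.
by rewrite (bigD1 j) //= jT (negPf jS) mul0r.
Qed.

(** Completeness of the characters, in the form of a reproducing kernel. *)
Lemma sum_chi x y :
  \sum_J chi R J x * chi R J y = if x == y then #|cube n|%:R else 0.
Proof.
transitivity (\prod_(j in [set: 'I_n])
   (1 + coordinate R x j * coordinate R y j)).
  rewrite -sum_subsets_prod; apply: eq_big => J; first by rewrite subsetT.
  by move=> _; rewrite -big_split.
case: eqVneq => [<-|neq].
  rewrite (eq_bigr (fun=> 2%:R)); last first.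
    by move=> j _; rewrite /coordinate -signr_addb addbb -natr1 addrC.
  by rewrite prodr_const cardsT card_ffun card_bool natrX.
have [j neqj] : exists j, x j != y j.
  by apply/existsP; apply: contraNT neq => /existsPn eqx; apply/eqP/ffunP=> j;
     apply/eqP/negPn/eqx.
rewrite (bigD1 j) ?inE //= /coordinate -signr_addb.
by rewrite -negb_eqb neqj expr1 subrr mul0r.
Qed.

Lemma fourier_inversion F x : F x = \sum_J fourier F J * chi R J x.
Proof.
rewrite /fourier /expectation.
transitivity (\sum_J \sum_y (F y / #|cube n|%:R) * (chi R J y * chi R J x)).
  rewrite exchange_big /= (bigD1 x) //= -mulr_sumr sum_chi eqxx.
  rewrite divfK ?gt_eqF ?card_cube_gt0 // big1 ?addr0 // => y neq.
  by rewrite -mulr_sumr sum_chi (negPf neq) mulr0.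
apply: eq_bigr => J _; rewrite mulr_suml mulr_suml; apply: eq_bigr => y _.
by ring.
Qed.

Lemma expectation_mul_chi_sum F (P : pred {set 'I_n}) (a : {set 'I_n} -> R) :
  expectation (fun x => F x * \sum_(J | P J) a J * chi R J x) =
  \sum_(J | P J) a J * fourier F J.
Proof.
rewrite (expectation_ext (G := fun x =>
  \sum_(J | P J) a J * (F x * chi R J x))).
  by rewrite expectation_sum; apply: eq_bigr => J _; rewrite expectationZ.
by move=> x; rewrite mulr_sumr; apply: eq_bigr => J _; ring.
Qed.

Lemma plancherel F G :
  expectation (fun x => F x * G x) = \sum_J fourier F J * fourier G J.
Proof.
rewrite (expectation_ext (G := fun x =>
  F x * \sum_J fourier G J * chi R J x)).
  by rewrite expectation_mul_chi_sum; apply: eq_bigr => J _; rewrite mulrC.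
by move=> x; rewrite -fourier_inversion.
Qed.

Lemma parseval F : sqnorm2 F = \sum_J fourier F J ^+ 2.
Proof. by rewrite -plancherel; apply: expectation_ext => x; rewrite expr2. Qed.

Lemma sqnorm2_ge0 F : 0 <= sqnorm2 F.
Proof. by apply: expectation_ge0 => x; apply: sqr_ge0. Qed.

Lemma fourier_sqr_le F J : fourier F J ^+ 2 <= sqnorm2 F.
Proof.
by rewrite parseval (bigD1 J) //= lerDl sumr_ge0 // => K _; apply: sqr_ge0.
Qed.

Lemma fourierB F G J :
  fourier (fun x => F x - G x) J = fourier F J - fourier G J.
Proof.
rewrite /fourier (expectation_ext (G := fun x =>
   F x * chi R J x + -1 * (G x * chi R J x))); last by move=> x; ring.
by rewrite expectationD expectationZ mulN1r.
Qed.

End Fourier.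

(** * Averaging over a set of coordinates *)

Section Projection.
Variables (R : realType) (n : nat).
Implicit Types (F G : cube n -> R) (x y : cube n) (I J S T U : {set 'I_n}).

(** The average of [F * chi U] over the coordinates in [S]. For [U] contained in
    [S] it is the part of the Fourier expansion of [F] with frequencies meeting
    [S] exactly in [U], divided by [chi U]; the case [S = U = I] is, up to the
    factor [chi I], the discrete derivative of [F] along [I], whose squared norm
    is the influence of [I]. *)
Definition proj S U F x : R :=
  (\sum_(T : {set 'I_n} | T \subset S) F (flip T x) * chi R U (flip T x))
  / 2 ^+ #|S|.

Lemma fourier_mul_chi F U J : [disjoint U & J] ->
  fourier (fun x => F x * chi R U x) J = fourier F (U :|: J).
Proof.
by move=> dUJ; apply: expectation_ext => x; rewrite chiU // mulrA.
Qed.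

Lemma fourier_proj S U F J : U \subset S ->
  fourier (proj S U F) J =
  if [disjoint S & J] then fourier F (U :|: J) else 0.
Proof.
move=> sUS; pose G x := F x * chi R U x.
transitivity ((\prod_(j in S) (1 + (-1) ^+ (j \in J))) / 2 ^+ #|S|
   * fourier G J).
  rewrite /fourier (expectation_ext (G := fun x => (2 ^+ #|S|)^-1 *
    \sum_(T : {set 'I_n} | T \subset S) G (flip T x) * chi R J x)); last first.
    by move=> x; rewrite /proj -mulr_suml; ring.
  rewrite expectationZ expectation_sum -sum_subsets_prod.
  rewrite mulrAC mulrC; congr (_ * _); rewrite mulr_suml.
  apply: eq_bigr => T _; rewrite -(expectation_flip T) -expectationZ.
  by apply: expectation_ext => x; rewrite flipK chi_flip; ring.
case: ifPn => [dSJ|/pred0Pn[j /andP[/= jS jJ]]]; last first.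
  by rewrite (bigD1 j jS) /= jJ expr1 subrr !mul0r.
rewrite -fourier_mul_chi; last by apply: disjointWl dSJ.
rewrite (eq_bigr (fun=> 2)); last first.
  by move=> j jS; rewrite (disjointFr dSJ jS) expr0.
by rewrite prodr_const divff ?mul1r // expf_neq0 // pnatr_eq0.
Qed.

(** The frequencies of [proj S U F] are the sets [J :\: U] with [J :&: S = U];
    this transfers sums over the spectrum of the projection to sums over the
    spectrum of [F]. *)
Lemma sum_fourier_proj S U F (w : {set 'I_n} -> R -> R) :
  U \subset S -> (forall J, w J 0 = 0) ->
  \sum_J w J (fourier (proj S U F) J) =
  \sum_(J : {set 'I_n} | J :&: S == U) w (J :\: U) (fourier F J).
Proof.
move=> sUS w0.
rewrite (bigID (fun J => [disjoint S & J])) /= [X in _ + X]big1 ?addr0.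
  rewrite [RHS](reindex_onto (fun J => U :|: J) (fun J => J :\: U)); last first.
    by move=> J /eqP <-; apply/setP => j; rewrite !inE;
       case: (j \in J); case: (j \in S).
  apply: eq_big => J.
    apply/idP/andP => [dSJ|[/eqP e1 /eqP e2]].
      split; apply/eqP/setP => j; rewrite !inE;
      have := @disjointFr _ _ _ j dSJ; have := subsetP sUS j;
      by case: (j \in J); case: (j \in S); case: (j \in U) => // a b;
         first [by have := a isT | by have := b isT].
    rewrite disjoint_subset; apply/subsetP => j jS; rewrite !inE.
    apply/negP => jJ; move/setP: e1 => /(_ j); move/setP: e2 => /(_ j).
    by rewrite !inE jJ jS !orbT !andbT => + /esym jU; rewrite jU.
  move=> dSJ; rewrite fourier_proj // dSJ; congr w.
  apply/setP => j; rewrite !inE; have := @disjointFr _ _ _ j dSJ.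
  have := subsetP sUS j.
  by case: (j \in J); case: (j \in S); case: (j \in U) => // a b;
     first [by have := a isT | by have := b isT].
by move=> J /negPf nd; rewrite fourier_proj // nd w0.
Qed.

Lemma sqnorm2_proj S U F : U \subset S ->
  sqnorm2 (proj S U F) =
  \sum_(J : {set 'I_n} | J :&: S == U) fourier F J ^+ 2.
Proof.
move=> sUS; rewrite parseval.
by rewrite (sum_fourier_proj F (w := fun _ a => a ^+ 2) sUS) // expr0n.
Qed.

Lemma sqnorm2_proj_self I F : sqnorm2 (proj I I F) = Tinfluence I F.
Proof.
rewrite sqnorm2_proj //; apply: eq_bigl => J.
by rewrite setIC; apply/eqP/setIidPl.
Qed.

Lemma expectation_proj S U F : U \subset S ->
  expectation (proj S U F) = fourier F U.
Proof.
move=> sUS; have := fourier_proj F set0 sUS.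
rewrite disjoint_sym disjoints_subset sub0set setU0 => <-.
by apply: expectation_ext => x; rewrite chi0 mulr1.
Qed.

(** [F] takes its values in the integer multiples of [e]. *)
Definition granular e F := forall x, exists z : int, F x = z%:~R * e.

Lemma granular_gap e F x : granular e F -> F x = 0 \/ `|e| <= `|F x|.
Proof.
move=> gF; have [z ->] := gF x; have [->|z0] := eqVneq z 0.
  by left; rewrite mul0r.
right; rewrite normrM ler_peMl // -intr_norm (ler_int _ 1).
by rewrite -gtz0_ge1 normr_gt0.
Qed.

(** The averages of an integer-valued function have denominator [2 ^ #|S|]. *)
Lemma granular_proj S U F : granular 1 F -> granular (2 ^- #|S|) (proj S U F).
Proof.
move=> gF x; rewrite /proj.
suff [z ->] : exists z : int,
   \sum_(T : {set 'I_n} | T \subset S) F (flip T x) * chi R U (flip T x) = z%:~R.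
  by exists z.
apply: (big_ind (fun a : R => exists z : int, a = z%:~R)).
- by exists 0.
- by move=> _ _ [a ->] [b ->]; exists (a + b); rewrite rmorphD.
move=> T _; have [z ->] := gF (flip T x).
have [b ->] := chi_sign R U (flip T x).
by exists (z * (-1) ^+ b); rewrite rmorphM rmorph_sign mulr1.
Qed.

Lemma granular_sign F : sign_valued F -> granular 1 F.
Proof.
move=> sF x; case: (sF x) => ->; first by exists (-1); rewrite rmorphN mulr1.
by exists 1; rewrite mulr1.
Qed.

End Projection.

(** * Hypercontractivity *)

Section Hypercontractivity.
Variables (R : realType) (n : nat).
Implicit Types (F G : cube n -> R) (S : {set 'I_n}).

(** Bonami's inequality for the exponents 2 and 4: the fourth moment of a
    multilinear polynomial is bounded by the squared second moment of the
    polynomial in which the monomials of degree [k] are scaled by [3 ^ (k / 2)]. *)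
Lemma bonami S (a : {set 'I_n} -> R) :
  expectation (fun x =>
    (\sum_(J : {set 'I_n} | J \subset S) a J * chi R J x) ^+ 4) <=
  (\sum_(J : {set 'I_n} | J \subset S) 3 ^+ #|J| * a J ^+ 2) ^+ 2.
Proof.
(* Induction on S: a polynomial in the coordinates of S is A + x_i B with A and
   B polynomials in the other coordinates, and the terms of odd degree in x_i
   of its fourth power have mean zero. *)
have [k] := ubnP #|S|; elim: k S a => // k IHk S a.
have [->|/set0Pn[i iS]] := eqVneq S set0.
  move=> _; rewrite (expectation_ext (G := fun=> a set0 ^+ 4)); last first.
    move=> x; rewrite (big_pred1 set0) ?chi0 ?mulr1 // => J.
    by rewrite subset0.
  rewrite expectation_cst (big_pred1 set0) => [|J]; last by rewrite subset0.
  by rewrite cards0 expr0 mul1r -exprM.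
move=> leSk; pose S' := S :\ i.
have iS' : i \notin S' by rewrite !inE eqxx.
have {leSk} leS'k : (#|S'| < k)%N by rewrite (cardsD1 i S) iS in leSk.
have split_sum (w : {set 'I_n} -> R) :
   \sum_(J : {set 'I_n} | J \subset S) w J =
   \sum_(J : {set 'I_n} | J \subset S') w J +
   \sum_(J : {set 'I_n} | J \subset S') w (i |: J).
  rewrite (bigID (fun J : {set 'I_n} => i \notin J)) /=; congr (_ + _).
    by apply: eq_bigl => J; rewrite subsetD1.
  rewrite (reindex_onto (fun J : {set 'I_n} => i |: J) (fun J => J :\ i)); last first.
    by move=> J /andP[_]; rewrite negbK; apply: setD1K.
  apply: eq_bigl => J; rewrite !inE eqxx /= andbT subUset sub1set iS /=.
  rewrite subsetD1; apply: andb_id2l => _.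
  apply/eqP/idP => [<-|iJ]; first by rewrite !inE eqxx.
  by rewrite setU1K.
pose A x : R := \sum_(J : {set 'I_n} | J \subset S') a J * chi R J x.
pose B x : R := \sum_(J : {set 'I_n} | J \subset S') a (i |: J) * chi R J x.
pose u := \sum_(J : {set 'I_n} | J \subset S') 3 ^+ #|J| * a J ^+ 2.
pose v := \sum_(J : {set 'I_n} | J \subset S') 3 ^+ #|J| * a (i |: J) ^+ 2.
have hA : expectation (fun x => A x ^+ 4) <= u ^+ 2 by apply: IHk.
have hB : expectation (fun x => B x ^+ 4) <= v ^+ 2.
  by apply: (IHk S' (fun J => a (i |: J))).
have u0 : 0 <= u.
  by apply: sumr_ge0 => J _; rewrite mulr_ge0 ?sqr_ge0 ?exprn_ge0.
have v0 : 0 <= v.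
  by apply: sumr_ge0 => J _; rewrite mulr_ge0 ?sqr_ge0 ?exprn_ge0.
have hAB : expectation (fun x => A x ^+ 2 * B x ^+ 2) <= u * v.
  have E0 : 0 <= expectation (fun x => A x ^+ 2 * B x ^+ 2).
    by apply: expectation_ge0 => x; rewrite mulr_ge0 ?sqr_ge0.
  have uv0 : 0 <= u * v by apply: mulr_ge0.
  rewrite -(@ler_pXn2r _ 2) ?nnegrE //.
  apply: le_trans (expectation_Cauchy_Schwarz _ _) _.
  rewrite exprMn ler_pM //; try by apply: expectation_ge0 => x; apply: sqr_ge0.
    by under expectation_ext => x do rewrite -exprM.
  by under expectation_ext => x do rewrite -exprM.
have flipE (c : {set 'I_n} -> R) x :
   \sum_(J : {set 'I_n} | J \subset S') c J * chi R J (flip [set i] x) =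
   \sum_(J : {set 'I_n} | J \subset S') c J * chi R J x.
  apply: eq_bigr => J sJ; rewrite chi_flip_disjoint // disjoints1.
  by apply: contra iS' => /(subsetP sJ).
pose c x := coordinate R x i.
have c2 x : c x ^+ 2 = 1 by rewrite /c /coordinate sqrr_sign.
have flipc x : c (flip [set i] x) = - c x.
  by rewrite /c /coordinate ffunE inE eqxx signr_addb expr1 mulrN1.
have odd0 : expectation (fun x =>
    c x * (4 * A x ^+ 3 * B x + 4 * A x * B x ^+ 3)) = 0.
  by apply: (@expectation_odd _ _ i) => x; rewrite flipc /A /B !flipE mulNr.
rewrite (expectation_ext (G := fun x => A x ^+ 4 + (6 * (A x ^+ 2 * B x ^+ 2) +
   (B x ^+ 4 + c x * (4 * A x ^+ 3 * B x + 4 * A x * B x ^+ 3))))); last first.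
  move=> x; rewrite split_sum -/(A x).
  have -> : \sum_(J : {set 'I_n} | J \subset S') a (i |: J) * chi R (i |: J) x
     = c x * B x.
    rewrite mulr_sumr; apply: eq_bigr => J sJ.
    rewrite chiU ?disjoints1; last by apply: contra iS' => /(subsetP sJ).
    by rewrite {1}/chi big_set1 -/(c x); ring.
  have -> : (A x + c x * B x) ^+ 4 = A x ^+ 4 + 6 * c x ^+ 2 * A x ^+ 2 * B x ^+ 2
    + (c x ^+ 2) ^+ 2 * B x ^+ 4 + c x * (4 * A x ^+ 3 * B x +
      4 * c x ^+ 2 * A x * B x ^+ 3) by ring.
  by rewrite c2; ring.
rewrite !expectationD odd0 expectationZ split_sum -/u.
have -> : \sum_(J : {set 'I_n} | J \subset S') 3 ^+ #|i |: J| * a (i |: J) ^+ 2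
   = 3 * v.
  rewrite mulr_sumr; apply: eq_bigr => J sJ; rewrite cardsU1.
  have -> : i \notin J by apply: contra iS' => /(subsetP sJ).
  by rewrite add1n exprS mulrA.
nra.
Qed.

(** A function which is at least [e] in absolute value wherever it does not
    vanish has little weight on low frequencies if its norm is small. This is
    the dual hypercontractive inequality, from exponent 4/3 to exponent 2, in
    which the norm of exponent 4/3 is bounded using the gap. *)
Lemma noise_gap (e : R) F : 0 < e -> (forall x, F x = 0 \/ e <= `|F x|) ->
  \sum_(J : {set 'I_n}) 3 ^- #|J| * fourier F J ^+ 2 <=
  e^-1 * sqnorm2 F * Num.sqrt (sqnorm2 F).
Proof.
move=> e0 gap; set s := leLHS.
have [v vE] : exists v, v = sqnorm2 F by exists (sqnorm2 F).
rewrite -vE.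
have s0 : 0 <= s.
  by apply: sumr_ge0 => J _; rewrite mulr_ge0 ?sqr_ge0 ?invr_ge0 ?exprn_ge0.
have v0 : 0 <= v by rewrite vE sqnorm2_ge0.
pose H x : R := \sum_(J : {set 'I_n}) (3 ^- #|J| * fourier F J) * chi R J x.
pose Z x : R := (F x != 0)%:R.
have EFH : expectation (fun x => F x * H x) = s.
  rewrite expectation_mul_chi_sum; apply: eq_bigr => J _; ring.
have EH4 : expectation (fun x => H x ^+ 4) <= s ^+ 2.
  have := bonami setT (fun J => 3 ^- #|J| * fourier F J).
  rewrite (expectation_ext (G := fun x => H x ^+ 4)); last first.
    by move=> x; congr (_ ^+ _); apply: eq_bigl => J; rewrite subsetT.
  move/le_trans; apply; rewrite le_eqVlt; apply/orP; left; apply/eqP.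
  congr (_ ^+ _); apply: eq_big => J; first by rewrite subsetT.
  by rewrite exprMn => _; field; rewrite expf_neq0 // pnatr_eq0.
have EZ : expectation Z <= e ^- 2 * v.
  rewrite vE -expectationZ; apply: ler_expectation => x; rewrite /Z.
  have [->|Fx0] := eqVneq (F x) 0; first by rewrite expr0n mulr0.
  have [/eqP|gx] := gap x; first by rewrite (negPf Fx0).
  rewrite ler_pdivlMl ?exprn_gt0 // mulr1 -[leRHS]real_normK ?num_real //.
  by rewrite ler_pXn2r ?nnegrE ?normr_ge0 // ltW.
have ZZ x : Z x ^+ 2 = Z x by rewrite /Z; case: (F x != 0); rewrite ?expr0n ?expr1n.
have EZH0 : 0 <= expectation (fun x => Z x * H x ^+ 2).
  by apply: expectation_ge0 => x; apply: mulr_ge0; rewrite ?sqr_ge0 // ler0n.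
(* s is the scalar product of F and H; two applications of the Cauchy-Schwarz
   inequality replace H by its fourth moment on the support of F. *)
have le1 : s ^+ 2 <= v * expectation (fun x => Z x * H x ^+ 2).
  rewrite -EFH (expectation_ext (G := fun x => F x * (Z x * H x))); last first.
    by move=> x; rewrite /Z; case: eqVneq => [->|_]; rewrite ?mul0r ?mul1r.
  apply: le_trans (expectation_Cauchy_Schwarz _ _) _; rewrite vE.
  by rewrite (expectation_ext (F := fun x => (Z x * H x) ^+ 2)
    (G := fun x => Z x * H x ^+ 2)) // => x; rewrite exprMn ZZ.
have le2 : expectation (fun x => Z x * H x ^+ 2) ^+ 2 <= e ^- 2 * v * s ^+ 2.
  apply: le_trans (expectation_Cauchy_Schwarz _ _) _.
  apply: ler_pM => //; try by apply: expectation_ge0 => x; apply: sqr_ge0.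
    by rewrite (expectation_ext (G := Z)).
  by rewrite (expectation_ext (G := fun x => H x ^+ 4)) // => x; rewrite -exprM.
have e20 : 0 <= e ^- 2 by rewrite invr_ge0 exprn_ge0 // ltW.
have rhs0 : 0 <= e^-1 * v * Num.sqrt v.
  apply: mulr_ge0 (sqrtr_ge0 _); apply: mulr_ge0 v0.
  by rewrite invr_ge0 ltW.
rewrite -(@ler_pXn2r _ 2) ?nnegrE // !exprMn sqr_sqrtr // exprVn.
have [->|s_neq0] := eqVneq s 0; first by
  rewrite expr0n /=; apply: mulr_ge0 v0; apply: mulr_ge0 e20 (sqr_ge0 v).
have s2 : 0 < s ^+ 2 by rewrite exprn_gt0 // lt_neqAle eq_sym s_neq0.
rewrite -(ler_pM2r s2); apply: le_trans (_ : v ^+ 2 *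
   expectation (fun x => Z x * H x ^+ 2) ^+ 2 <= _).
  by rewrite -expr2 -exprMn ler_pXn2r ?nnegrE ?sqr_ge0 // mulr_ge0.
apply: le_trans (ler_wpM2l (sqr_ge0 v) le2) _.
by rewrite le_eqVlt; apply/orP; left; apply/eqP; ring.
Qed.

End Hypercontractivity.

(** * Counting and elementary estimates *)

Lemma card_between (T : finType) (U J : {set T}) (m : nat) :
  U \subset J -> (#|U| <= m)%N ->
  #|[set I : {set T} | [&& U \subset I, #|I| == m & I \subset J]]| =
  'C(#|J :\: U|, m - #|U|).
Proof.
move=> sUJ leUm; rewrite -cards_draws.
have cancelU (A : {set T}) : [disjoint A & U] -> (U :|: A) :\: U = A.
  move=> dAU; rewrite setDUl setDv set0U.
  by apply/setDidPl.
rewrite -[RHS](card_in_imset (f := fun A => U :|: A)); last first.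
  move=> A B; rewrite !inE !subsetD => /andP[/andP[_ dA] _] /andP[/andP[_ dB] _].
  by move=> eqAB; rewrite -(cancelU A dA) eqAB cancelU.
apply: eq_card => I; rewrite inE; apply/and3P/imsetP.
  move=> [sUI /eqP cI sIJ]; exists (I :\: U).
    by rewrite inE setSD //= cardsD (setIidPr sUI) cI eqxx.
  by rewrite setDE setUIr setUCr setIT; apply/esym/setUidPr.
move=> [A]; rewrite inE subsetD => /andP[/andP[sAJ dA] /eqP cA] ->.
split; first exact: subsetUl; last by rewrite subUset sUJ.
by rewrite cardsU disjoint_setI0 1?disjoint_sym // cards0 subn0 cA subnKC.
Qed.

(** Double counting of the pairs [I \subset J] with [I] of size [m] above [U]. *)
Lemma sum_supersets_card (R : pzSemiRingType) (T : finType) (U : {set T}) (m : nat)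
    (phi : {set T} -> R) : (#|U| <= m)%N ->
  \sum_(I : {set T} | (U \subset I) && (#|I| == m))
    \sum_(J : {set T} | I \subset J) phi J =
  \sum_(J : {set T} | U \subset J) 'C(#|J :\: U|, m - #|U|)%:R * phi J.
Proof.
move=> leUm.
rewrite (exchange_big_dep (fun J : {set T} => U \subset J)) /=; last first.
  by move=> I J /andP[sUI _]; apply: subset_trans.
apply: eq_bigr => J sUJ; rewrite sumr_const -card_between // mulr_natl.
by congr (_ *+ _); apply: eq_card => I; rewrite inE unfold_in andbA.
Qed.

Lemma leq_bin_exp n k : ('C(n, k) <= n ^ k)%N.
Proof.
elim: k n => [|k IHk] [|n]; rewrite ?bin0 //.
have := mul_bin_diag n.+1 k; have := IHk n; rewrite expnS => le1 eq1.
have le2 : (n ^ k <= n.+1 ^ k)%N by case: k {IHk le1 eq1} => // k; rewrite leq_exp2r.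
have : (n.+1 * 'C(n, k) <= n.+1 * n.+1 ^ k)%N.
  by rewrite leq_mul2l (leq_trans le1).
by rewrite eq1; apply: leq_trans; apply: leq_pmull.
Qed.

Lemma leq_exp_bin j k : (k <= j)%N -> (j ^ k <= k ^ k * 'C(j, k))%N.
Proof.
elim: k j => [|k IHk] [|j] //; rewrite ltnS => lekj.
have -> : (k.+1 ^ k.+1 * 'C(j.+1, k.+1) = j.+1 * (k.+1 ^ k * 'C(j, k)))%N.
  by rewrite expnSr -mulnA -[in LHS](mul_bin_diag j.+1 k) /=; ring.
rewrite expnS leq_mul2l /=.
have [->|k_gt0] := posnP k; first by rewrite !expn0 bin0.
rewrite -(leq_pmul2l (_ : 0 < k ^ k)%N) ?expn_gt0 ?k_gt0 //.
apply: (@leq_trans ((k.+1 * j) ^ k)).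
  by rewrite -expnMn leq_exp2r //; lia.
by rewrite expnMn mulnCA leq_mul2l (IHk j lekj) orbT.
Qed.

Section Estimates.
Variable R : realType.
Implicit Types t : R.

Lemma exp_half_ge t m : 0 <= t -> t ^+ m.+1 <= (2 * m.+1)%:R ^+ m.+1 * expR (t / 2).
Proof.
move=> t0; have m0 : 0 < (2 * m.+1)%:R :> R by rewrite ltr0n.
rewrite -[in leRHS](_ : m.+1%:R * (t / (2 * m.+1)%:R) = t / 2); last first.
  have : m.+1%:R != 0 :> R by rewrite pnatr_eq0.
  by rewrite natrM; move: m.+1%:R => a a0; field.
rewrite expRM_natl -exprMn ler_pXn2r ?nnegrE ?mulr_ge0 ?expR_ge0 ?ler0n //.
rewrite -ler_pdivrMl //; apply: le_trans (expR_ge1Dx _).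
by rewrite [_^-1 * _]mulrC lerDr.
Qed.

(** The first term bounds 1 when [j <= t / 4], because then
    [3 ^ j <= expR (t / 2)]; the second one does when [j > t / 4], because
    ['C(j, k) >= (j / k) ^ k]. *)
Lemma binomial_trade_off t (j k : nat) : 0 < t -> (1 <= k)%N -> (k <= j)%N ->
  1 <= 'C(j, k)%:R * (expR (t / 2) * 3 ^- j + (4 * k%:R / t) ^+ k).
Proof.
move=> t0 k1 kj.
have A0 : 0 <= expR (t / 2) * 3 ^- j.
  by rewrite mulr_ge0 ?expR_ge0 // invr_ge0 exprn_ge0.
have B0 : 0 <= (4 * k%:R / t) ^+ k.
  by rewrite exprn_ge0 // divr_ge0 ?(ltW t0) // mulr_ge0 // ler0n.
have C1 : 1 <= 'C(j, k)%:R :> R by rewrite ler1n bin_gt0.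
have C0 : 0 <= 'C(j, k)%:R :> R by rewrite ler0n.
rewrite mulrDr; have [le_jt|lt_tj] := lerP j%:R (t / 4).
  rewrite -[leLHS]addr0 lerD //; last exact: mulr_ge0.
  apply: (le_trans C1); rewrite ler_peMr // ler_pdivlMr ?exprn_gt0 //.
  rewrite mul1r; apply: (@le_trans _ _ (expR (j%:R * 2))).
    rewrite expRM_natl ler_pXn2r ?nnegrE ?expR_ge0 //; last exact: leq_trans kj.
    by apply: le_trans (expR_ge1Dx _); lra.
  by rewrite ler_expR; lra.
rewrite -[leLHS]add0r lerD //; first exact: mulr_ge0.
have : (j ^ k)%:R <= (k ^ k * 'C(j, k))%:R :> R by rewrite ler_nat leq_exp_bin.
rewrite natrM !natrX => le1.
apply: (@le_trans _ _ ((4 / t) ^+ k * j%:R ^+ k)).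
  rewrite -exprMn exprn_ege1 // mulrAC ler_pdivlMr // mul1r; lra.
have : 0 <= (4 / t) ^+ k by rewrite exprn_ge0 // divr_ge0 // ltW.
move=> h; apply: le_trans (ler_wpM2l h le1) _.
by rewrite le_eqVlt !exprMn; apply/orP; left; apply/eqP; ring.
Qed.

End Estimates.

(** * Small influences of order d + 1 *)

Section Influences.
Variables (R : realType) (n : nat).
Implicit Types (F : cube n -> R) (I J U : {set 'I_n}).

Lemma Tinfluence_ge0 I F : 0 <= Tinfluence I F.
Proof. by apply: sumr_ge0 => J _; apply: sqr_ge0. Qed.

(** Hypercontractivity for the discrete derivative along [I]. *)
Lemma noise_influence I F : granular 1 F ->
  \sum_(J : {set 'I_n} | I \subset J) 3 ^- #|J :\: I| * fourier F J ^+ 2 <=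
  2 ^+ #|I| * Tinfluence I F * Num.sqrt (Tinfluence I F).
Proof.
move=> gF; have e0 : 0 < 2 ^- #|I| :> R by rewrite invr_gt0 exprn_gt0.
have gap x : proj I I F x = 0 \/ 2 ^- #|I| <= `|proj I I F x|.
  by have := granular_gap x (granular_proj I I gF); rewrite gtr0_norm.
have := noise_gap e0 gap; rewrite sqnorm2_proj_self invrK.
rewrite (sum_fourier_proj F (w := fun J a => 3 ^- #|J| * a ^+ 2)) //; last first.
  by move=> J; rewrite expr0n mulr0.
rewrite (eq_bigl (fun J : {set 'I_n} => I \subset J)) // => J.
by rewrite setIC; apply/eqP/setIidPl.
Qed.

Lemma low_degree_influence d I F : granular 1 F ->
  \sum_(J : {set 'I_n} | (I \subset J) && (#|J| <= d)%N) fourier F J ^+ 2 <=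
  3 ^+ d * (2 ^+ #|I| * Tinfluence I F * Num.sqrt (Tinfluence I F)).
Proof.
move=> gF; have p3 k : 0 < 3 ^+ k :> R by rewrite exprn_gt0.
apply: le_trans (ler_wpM2l (ltW (p3 d)) (noise_influence I gF)).
rewrite mulr_sumr [leLHS]big_mkcondr /=; apply: ler_sum => J sIJ.
have f0 := sqr_ge0 (fourier F J).
case: ifP => [leJd|_]; last first.
  by rewrite mulr_ge0 ?(ltW (p3 _)) // mulr_ge0 // invr_ge0 ltW.
rewrite mulrA ler_peMl // ler_pdivlMr // mul1r ler_eXn2l ?ltr1n //.
by apply: leq_trans leJd; rewrite subset_leq_card // subsetDl.
Qed.

Lemma sum_supersets_le U m (c : R) : 0 <= c -> (#|U| <= m)%N ->
  \sum_(I : {set 'I_n} | (U \subset I) && (#|I| == m)) c <=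
  n%:R ^+ (m - #|U|) * c.
Proof.
move=> c0 leUm; rewrite sumr_const -[leLHS]mulr_natl ler_wpM2r // -natrX ler_nat.
have := card_between (subsetT U) leUm; set k := (m - _)%N.
have -> : #|[set I : {set 'I_n} | [&& U \subset I, #|I| == m & I \subset setT]]|
    = #|[pred I : {set 'I_n} | (U \subset I) && (#|I| == m)]|.
  by apply: eq_card => I; rewrite !inE subsetT andbT.
move=> ->; apply: leq_trans (leq_bin_exp _ _) _.
have : (#|[set: 'I_n] :\: U| <= n)%N.
  by rewrite -[leqRHS]card_ord; apply: max_card.
by case: k => // k; rewrite leq_exp2r.
Qed.

(** The argument of Kahn, Kalai and Linial for the frequencies above [U]: summing
    over the sets [I] of size [d + 1] that contain [U], the frequencies of size
    at most a multiple of [t] are controlled by hypercontractivity, and the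
    larger ones are counted with a multiplicity of order [t ^ k]. *)
Lemma upper_weight_le d (t eta : R) U F :
  0 < t -> 0 <= eta -> (#|U| <= d)%N -> granular 1 F ->
  (forall I, #|I| = d.+1 -> Tinfluence I F <= eta) ->
  let k := (d.+1 - #|U|)%N in
  \sum_(J : {set 'I_n} | (U \subset J) && (d < #|J|)%N) fourier F J ^+ 2 <=
  n%:R ^+ k * (expR (t / 2) * (2 ^+ d.+1 * eta * Num.sqrt eta) +
               (4 * k%:R / t) ^+ k * eta).
Proof.
move=> t0 eta0 leUd gF infF; cbv zeta; set k := (_ - _)%N.
set A := expR (t / 2); set B := (_ / t) ^+ k.
have A0 : 0 <= A by apply: expR_ge0.
have B0 : 0 <= B by rewrite exprn_ge0 // divr_ge0 ?(ltW t0) // mulr_ge0 // ler0n.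
have leUm : (#|U| <= d.+1)%N by apply: leqW.
pose phi J : R := (A * 3 ^- #|J :\: U| + B) * fourier F J ^+ 2.
have phi0 J : 0 <= phi J.
  rewrite mulr_ge0 ?sqr_ge0 // addr_ge0 // mulr_ge0 // invr_ge0 exprn_ge0 //.
apply: (@le_trans _ _ (\sum_(J : {set 'I_n} | U \subset J)
    'C(#|J :\: U|, k)%:R * phi J)).
  rewrite [leLHS]big_mkcondr /=; apply: ler_sum => J sUJ.
  case: ifP => [ltdJ|_]; last by rewrite mulr_ge0 ?ler0n.
  rewrite mulrA ler_peMl ?sqr_ge0 //; apply: binomial_trade_off => //.
    by rewrite subn_gt0 ltnS.
  by rewrite cardsD (setIidPr sUJ); apply: leq_sub2r.
rewrite -sum_supersets_card //.
apply: le_trans (sum_supersets_le _ leUm); last first.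
  have X0 : 0 <= 2 ^+ d.+1 * eta * Num.sqrt eta.
    by rewrite mulr_ge0 ?sqrtr_ge0 // mulr_ge0 // exprn_ge0.
  by apply: addr_ge0; apply: mulr_ge0.
apply: ler_sum => I /andP[sUI /eqP cI].
have v0 := Tinfluence_ge0 I F; have lev := infF I cI.
have noise := noise_influence I gF; rewrite cI in noise.
rewrite (eq_bigr (fun J : {set 'I_n} => A * (3 ^- #|J :\: U| * fourier F J ^+ 2)
   + B * fourier F J ^+ 2)); last by move=> J _; rewrite /phi; ring.
rewrite big_split -!mulr_sumr /= lerD ?ler_wpM2l //.
apply: (@le_trans _ _ (2 ^+ d.+1 * Tinfluence I F * Num.sqrt (Tinfluence I F))).
  apply: le_trans noise; apply: ler_sum => J sIJ.
  rewrite ler_wpM2r ?sqr_ge0 // lef_pV2 ?posrE ?exprn_gt0 //.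
  by rewrite ler_eXn2l ?ltr1n // subset_leq_card // setDS.
apply: ler_pM; rewrite ?sqrtr_ge0 //; last exact: ler_wsqrtr.
  by rewrite mulr_ge0 // exprn_ge0.
by rewrite ler_wpM2l // exprn_ge0.
Qed.

End Influences.

Section LogarithmicBounds.
Variables (R : realType) (n : nat).
Hypothesis n_gt1 : (1 < n)%N.

Let t : R := ln n%:R.
Let delta : R := ln n%:R / n%:R.

Lemma expR_ln_nat : expR t = n%:R.
Proof. by rewrite lnK // posrE ltr0n ltnW. Qed.

Lemma ln_nat_gt0 : 0 < t.
Proof. by rewrite ln_gt0 // ltr1n. Qed.

Lemma ln_ratio_ge0 : 0 <= delta.
Proof. by rewrite divr_ge0 ?ler0n // ltW // ln_nat_gt0. Qed.

Lemma ln_ratio_le1 : delta <= 1.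
Proof.
rewrite ler_pdivrMr ?ltr0n 1?ltnW // mul1r -/t -expR_ln_nat.
by apply: le_trans (expR_ge1Dx _); rewrite lerDr.
Qed.

(** Equivalently, [n * delta ^ (3/2)] is bounded. *)
Lemma ln_ratio_sqr_bound : t ^+ 2 * delta <= 216.
Proof.
have n0 : 0 < n%:R :> R by rewrite ltr0n ltnW.
rewrite mulrA -exprSr ler_pdivrMr // -expR_ln_nat.
have := exp_half_ge 2 (ltW ln_nat_gt0); rewrite -natrX.
move/le_trans; apply; rewrite ler_wpM2l // ler_expR.
by have := ln_nat_gt0; lra.
Qed.

End LogarithmicBounds.

(** The constant in the bound on the Fourier weight above degree [d]. *)
Definition upper_const (R : realType) (d : nat) : R :=
  2 ^+ d.+1 * (2 * d.+2)%:R ^+ d.+2 + (4 * d.+1)%:R ^+ d.+1.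

Lemma upper_const_ge1 (R : realType) d : 1 <= upper_const R d.
Proof.
rewrite /upper_const -!natrX -natrM -natrD ler1n addn_gt0 muln_gt0 !expn_gt0.
by rewrite !muln_gt0.
Qed.

Section UpperWeight.
Variables (R : realType) (n d : nat) (F : cube n -> R) (alpha : R).
Let delta : R := ln n%:R / n%:R.
Hypotheses (d_gt0 : (0 < d)%N) (ltdn : (d < n)%N) (gF : granular 1 F).
Hypotheses (alpha_gt0 : 0 < alpha) (alpha_le1 : alpha <= 1).
Hypothesis infF : forall I : {set 'I_n}, #|I| = d.+1 ->
  Tinfluence I F <= alpha * delta ^+ d.+1.

(** The case [t = ln n] of the previous bound. With [n ^ k * eta] equal to
    [alpha * delta ^ #|U| * t ^ k], the factor [t ^ k] is absorbed by the
    multiplicity in the second term and by [sqrt eta <= delta] in the first. *)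
Lemma upper_weight (U : {set 'I_n}) : (#|U| <= d)%N ->
  \sum_(J : {set 'I_n} | (U \subset J) && (d < #|J|)%N) fourier F J ^+ 2 <=
  upper_const R d * alpha * delta ^+ #|U|.
Proof.
move=> leUd; have n_gt1 : (1 < n)%N by apply: leq_trans ltdn.
have t0 := ln_nat_gt0 R n_gt1; have d0 := ln_ratio_ge0 R n_gt1.
have d1 := ln_ratio_le1 R n_gt1; have et := expR_ln_nat R n_gt1.
have n0 : n%:R != 0 :> R by rewrite pnatr_eq0; lia.
rewrite -/delta in d0 d1; have eta0 : 0 <= alpha * delta ^+ d.+1.
  by rewrite mulr_ge0 ?exprn_ge0 ?(ltW alpha_gt0).
apply: le_trans (upper_weight_le t0 eta0 leUd gF infF) _.
set k := (d.+1 - #|U|)%N; set t : R := ln n%:R; set e := expR (t / 2).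
have ee : e * e = n%:R by rewrite -expRD -splitr et.
have e0 : 0 < e by apply: expR_gt0.
set s := Num.sqrt _; set eta := alpha * _.
have s0 : 0 <= s by apply: sqrtr_ge0.
have les : s <= delta.
  rewrite -[leRHS]ger0_norm // -sqrtr_sqr ler_wsqrtr //.
  apply: (@le_trans _ _ (1 * delta ^+ d.+1)).
    by rewrite ler_wpM2r // exprn_ge0.
  by rewrite mul1r ler_wiXn2l.
have nk_eta : n%:R ^+ k * eta = alpha * delta ^+ #|U| * t ^+ k.
  rewrite /eta (_ : d.+1 = k + #|U|)%N; last by rewrite /k; lia.
  by rewrite exprD {1}/delta -/t expr_div_n; field; rewrite expf_neq0.
have ekd : e * s * t ^+ k <= (2 * d.+2)%:R ^+ d.+2.
  apply: (@le_trans _ _ (e * delta * t ^+ k)).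
    by rewrite ler_wpM2r ?exprn_ge0 ?(ltW t0) // ler_wpM2l // ltW.
  have -> : e * delta * t ^+ k = t ^+ k.+1 / e.
    by rewrite /delta -/t -ee exprS; field; rewrite gt_eqF.
  rewrite ler_pdivrMr //; apply: le_trans (exp_half_ge k (ltW t0)) _.
  rewrite ler_wpM2r ?(ltW e0) // -!natrX ler_nat.
  apply: (@leq_trans ((2 * d.+2) ^ k.+1)).
    by rewrite leq_exp2r // leq_mul2l /= ltnS leq_subr.
  by rewrite leq_pexp2l // ltnS leq_subr.
have kkd : (4 * k%:R / t) ^+ k * t ^+ k <= (4 * d.+1)%:R ^+ d.+1.
  rewrite -exprMn divfK ?gt_eqF // -natrM -!natrX ler_nat.
  apply: (@leq_trans ((4 * d.+1) ^ k)); last by rewrite leq_pexp2l // leq_subr.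
  have : (k <= d.+1)%N by rewrite leq_subr.
  case: (k) => // k'; by move=> h; rewrite leq_exp2r // leq_mul2l.
have -> : n%:R ^+ k * (e * (2 ^+ d.+1 * eta * s) + (4 * k%:R / t) ^+ k * eta) =
  alpha * delta ^+ #|U| * (2 ^+ d.+1 * (e * s * t ^+ k) +
     (4 * k%:R / t) ^+ k * t ^+ k).
  transitivity (n%:R ^+ k * eta * (e * 2 ^+ d.+1 * s + (4 * k%:R / t) ^+ k)).
    by ring.
  by rewrite nk_eta; ring.
have ad0 : 0 <= alpha * delta ^+ #|U| by
  rewrite mulr_ge0 ?exprn_ge0 ?(ltW alpha_gt0).
rewrite -[leRHS]mulrA [leRHS]mulrC ler_wpM2l //.
by rewrite lerD // ler_wpM2l // exprn_ge0.
Qed.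

End UpperWeight.

(** * Concentration on few coordinates *)

(** The threshold between large and small influences: at this value of [v],
    [3 ^ d * 2 * v * sqrt v] is [v / 2]. *)
Definition influence_threshold (R : realType) (d : nat) : R := (4 * 3 ^+ d) ^- 2.

(** The coordinates of influence above the threshold. *)
Definition influential (R : realType) (n d : nat) (F : cube n -> R) : {set 'I_n} :=
  [set i | influence_threshold R d < Tinfluence [set i] F].

(** The constant in the bound on the Fourier weight of frequencies that are
    not made of influential coordinates. *)
Definition junta_const (R : realType) (d : nat) : R :=
  upper_const R d + 3 ^+ d * 4 * 432 * upper_const R d ^+ 2.

Section Concentration.
Variables (R : realType) (n d : nat) (F : cube n -> R) (alpha : R).
Let delta : R := ln n%:R / n%:R.
Let beta : R := upper_const R d * alpha * delta.
Let low (i : 'I_n) : R := \sum_(J : {set 'I_n} | (i \in J) && (#|J| <= d)%N)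
  fourier F J ^+ 2.
Hypotheses (d_gt0 : (0 < d)%N) (ltdn : (d < n)%N) (gF : granular 1 F).
Hypotheses (alpha_gt0 : 0 < alpha) (alpha_le1 : alpha <= 1).
Hypothesis infF : forall I : {set 'I_n}, #|I| = d.+1 ->
  Tinfluence I F <= alpha * delta ^+ d.+1.

Let n_gt1 : (1 < n)%N. Proof. exact: leq_trans ltdn. Qed.
Let delta_ge0 : 0 <= delta. Proof. exact: ln_ratio_ge0. Qed.
Let K1_ge1 := upper_const_ge1 R d.
Let beta_ge0 : 0 <= beta.
Proof.
rewrite mulr_ge0 // mulr_ge0 ?(ltW alpha_gt0) //.
by apply: le_trans K1_ge1.
Qed.

Let low_le i : low i <=
  3 ^+ d * (2 * Tinfluence [set i] F * Num.sqrt (Tinfluence [set i] F)).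
Proof.
have := low_degree_influence d [set i] gF; rewrite cards1 expr1.
by under eq_bigl => J do rewrite sub1set.
Qed.

Let influence_split i : Tinfluence [set i] F <= low i + beta.
Proof.
rewrite /Tinfluence (bigID (fun J : {set 'I_n} => (#|J| <= d)%N)) /= lerD //.
  rewrite le_eqVlt; apply/orP; left; apply/eqP.
  by apply: eq_bigl => J; rewrite sub1set.
have := upper_weight d_gt0 ltdn gF alpha_gt0 alpha_le1 infF (U := [set i]).
rewrite cards1 expr1 => /(_ d_gt0); apply: le_trans; rewrite le_eqVlt.
apply/orP; left; apply/eqP.
by apply: eq_bigl => J; rewrite ltnNge.
Qed.

(** By hypercontractivity the part of degree at most [d] of a small influence [v]
    is at most [v / 2], so that [v] is carried by the part of degree above
    [d], which is at most [beta]. *)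
Lemma influence_dichotomy i : i \notin influential d F ->
  Tinfluence [set i] F <= 2 * beta.
Proof.
rewrite inE -leNgt => small; have := influence_split i; have := low_le i.
have v0 := Tinfluence_ge0 [set i] F.
have p0 : 0 < 4 * 3 ^+ d :> R by rewrite mulr_gt0 // exprn_gt0.
have le_sqrt : Num.sqrt (Tinfluence [set i] F) <= (4 * 3 ^+ d)^-1.
  rewrite -[leRHS]ger0_norm ?invr_ge0 ?(ltW p0) // -sqrtr_sqr ler_wsqrtr //.
  by rewrite exprVn.
move: (Tinfluence _ _) v0 le_sqrt => v v0 le_sqrt le1 le2.
suff : 3 ^+ d * (2 * v * Num.sqrt v) <= v / 2 by lra.
apply: (@le_trans _ _ (3 ^+ d * (2 * v * (4 * 3 ^+ d)^-1))).
  by rewrite ler_wpM2l ?exprn_ge0 // ler_wpM2l // mulr_ge0.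
rewrite le_eqVlt; apply/orP; left; apply/eqP; field.
by rewrite expf_neq0 // pnatr_eq0.
Qed.

(** Each of the [n] coordinates off the influential ones contributes at most a
    constant multiple of [beta * sqrt beta], and [n * delta ^ (3/2)] is bounded. *)
Lemma weight_off_influential :
  \sum_(J : {set 'I_n} | ~~ (J \subset influential d F)) fourier F J ^+ 2 <=
  junta_const R d * alpha.
Proof.
set S := influential d F.
have up := upper_weight d_gt0 ltdn gF alpha_gt0 alpha_le1 infF (U := set0).
rewrite cards0 expr0 mulr1 in up.
have low_small i : i \notin S -> low i <= 3 ^+ d * (4 * beta * Num.sqrt (2 * beta)).
  move=> /influence_dichotomy le_v; apply: le_trans (low_le i) _.
  have v0 := Tinfluence_ge0 [set i] F.
  rewrite ler_wpM2l ?exprn_ge0 // ler_pM ?sqrtr_ge0 ?mulr_ge0 //; first by lra.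
  exact: ler_wsqrtr.
apply: (@le_trans _ _ (upper_const R d * alpha + \sum_(i | i \notin S) low i)).
  apply: (@le_trans _ _ (\sum_(J : {set 'I_n} | (set0 \subset J) && (d < #|J|)%N)
      fourier F J ^+ 2 + \sum_(i | i \notin S) low i)); last first.
    by rewrite lerD2r up.
  rewrite (exchange_big_dep predT) //= [leLHS]big_mkcond /=.
  rewrite [X in X + _]big_mkcond -big_split /=; apply: ler_sum => J _.
  have f0 := sqr_ge0 (fourier F J).
  have sum0 : 0 <= \sum_(i | (i \notin S) && ((i \in J) && (#|J| <= d)%N))
      fourier F J ^+ 2.
    by apply: sumr_ge0 => *; apply: sqr_ge0.
  rewrite sub0set /=; case: ifPn => [/subsetPn[i iJ iS]|_]; last first.
    by rewrite addr_ge0 //; case: ifP.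
  case: ltnP sum0 => [_|leJd] sum0; first by rewrite lerDl.
  rewrite add0r (bigD1 i) /=; last by rewrite iS iJ.
  by rewrite lerDl; apply: sumr_ge0 => *; apply: sqr_ge0.
rewrite /junta_const [leRHS]mulrDl lerD2l.
have X0 : 0 <= 3 ^+ d * (4 * beta * Num.sqrt (2 * beta)).
  by rewrite mulr_ge0 ?exprn_ge0 // mulr_ge0 ?sqrtr_ge0 // mulr_ge0.
apply: (@le_trans _ _ (n%:R * (3 ^+ d * (4 * beta * Num.sqrt (2 * beta))))).
  apply: (@le_trans _ _ (\sum_(i | i \notin S)
    3 ^+ d * (4 * beta * Num.sqrt (2 * beta)))); first exact: ler_sum.
  rewrite sumr_const -[leLHS]mulr_natl ler_wpM2r // ler_nat.
  by rewrite -[leqRHS]card_ord; apply: max_card.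
have n0 : n%:R != 0 :> R by rewrite pnatr_eq0; lia.
have t0 := ltW (ln_nat_gt0 R n_gt1); set t := ln _ in t0.
have nbeta : n%:R * beta = upper_const R d * alpha * t.
  by rewrite /beta /delta -/t; field.
have tsqrt : t * Num.sqrt (2 * beta) <= 432 * upper_const R d.
  have K0 : 0 <= 432 * upper_const R d by rewrite mulr_ge0 // (le_trans _ K1_ge1).
  rewrite -[leRHS]ger0_norm // -sqrtr_sqr -{1}[t]ger0_norm // -sqrtr_sqr.
  rewrite -sqrtrM ?sqr_ge0 // ler_wsqrtr //.
  have := ln_ratio_sqr_bound R n_gt1; rewrite -/t -/delta => le216.
  apply: (@le_trans _ _ (2 * upper_const R d * (t ^+ 2 * delta))).
    have -> : t ^+ 2 * (2 * beta) = alpha * (2 * upper_const R d * (t ^+ 2 * delta)).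
      by rewrite /beta; ring.
    have y0 : 0 <= 2 * upper_const R d * (t ^+ 2 * delta).
      apply: mulr_ge0; last by rewrite mulr_ge0 // sqr_ge0.
      by rewrite mulr_ge0 // (le_trans _ K1_ge1).
    by rewrite ler_piMl.
  apply: (@le_trans _ _ (2 * upper_const R d * 216)).
    by rewrite ler_wpM2l // mulr_ge0 // (le_trans _ K1_ge1).
  rewrite expr2 (_ : 2 * upper_const R d * 216 = 432 * upper_const R d); last by ring.
  by rewrite ler_peMr //; move: K1_ge1; lra.
have -> : n%:R * (3 ^+ d * (4 * beta * Num.sqrt (2 * beta))) =
   3 ^+ d * 4 * (n%:R * beta) * Num.sqrt (2 * beta) by ring.
rewrite nbeta.
have -> : 3 ^+ d * 4 * (upper_const R d * alpha * t) * Num.sqrt (2 * beta) =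
  (3 ^+ d * 4 * upper_const R d * alpha) * (t * Num.sqrt (2 * beta)) by ring.
have -> : 3 ^+ d * 4 * 432 * upper_const R d ^+ 2 * alpha =
  (3 ^+ d * 4 * upper_const R d * alpha) * (432 * upper_const R d) by ring.
rewrite ler_wpM2l //; apply: mulr_ge0 (ltW alpha_gt0); apply: mulr_ge0.
  by rewrite mulr_ge0 // exprn_ge0.
exact: le_trans K1_ge1.
Qed.

(** The influences of the part of degree at most [d] sum up to at most [d]. *)
Lemma card_influential : sqnorm2 F <= 1 ->
  upper_const R d * alpha <= influence_threshold R d / 2 ->
  (#|influential d F| <= 32 * d * 9 ^ d)%N.
Proof.
move=> F1 small; set c := influence_threshold R d in small.
have c_gt0 : 0 < c by rewrite invr_gt0 exprn_gt0 // mulr_gt0 // exprn_gt0.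
have le_beta : beta <= c / 2.
  apply: le_trans small; rewrite /beta ler_piMr ?ln_ratio_le1 //.
  by rewrite mulr_ge0 ?(ltW alpha_gt0) // (le_trans _ K1_ge1).
have low_big i : i \in influential d F -> c / 2 <= low i.
  by rewrite inE -/c => big; have := influence_split i; lra.
have sum_low : \sum_i low i <= d%:R.
  rewrite (exchange_big_dep predT) //=.
  apply: (@le_trans _ _ (\sum_(J : {set 'I_n}) d%:R * fourier F J ^+ 2)).
    apply: ler_sum => J _; rewrite sumr_const -[leLHS]mulr_natl.
    rewrite ler_wpM2r ?sqr_ge0 // ler_nat.
    have [leJd|ltdJ] := leqP #|J| d; last first.
      by rewrite eq_card0 // => i; rewrite unfold_in /= andbF.
    apply: leq_trans leJd; apply: subset_leq_card; apply/subsetP => i.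
    by rewrite unfold_in => /andP[].
  by rewrite -mulr_sumr -parseval ler_piMr ?ler0n.
have : #|influential d F|%:R * (c / 2) <= d%:R.
  apply: le_trans sum_low; rewrite mulr_natl -sumr_const.
  rewrite [leRHS](bigID (mem (influential d F))) /=.
  rewrite -[leLHS]addr0 lerD //; first exact: ler_sum.
  by apply: sumr_ge0 => i _; apply: sumr_ge0 => J _; apply: sqr_ge0.
rewrite -ler_pdivlMr ?divr_gt0 // -(ler_nat R) => /le_trans; apply.
rewrite /c /influence_threshold !natrM natrX (_ : 9 = 3 ^+ 2); last by ring.
rewrite le_eqVlt -exprM mulnC exprM; apply/orP; left; apply/eqP; field.
by rewrite expf_neq0 // pnatr_eq0.
Qed.

End Concentration.

(** * Sign-valued juntas and polynomials *)

Section SignValued.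
Variables (R : realType) (n : nat).
Implicit Types (F g : cube n -> R) (I J S : {set 'I_n}).

Lemma sqnorm2_sign F : sign_valued F -> sqnorm2 F = 1.
Proof.
move=> sF; rewrite -[RHS](@expectation_cst R n); apply: expectation_ext => x.
by case: (sF x) => ->; rewrite ?sqrrN expr1n.
Qed.

(** The witness is the sign of the average of [F] over the coordinates outside
    [S]. *)
Lemma exists_sign_junta S F : sign_valued F -> exists g : cube n -> R,
  [/\ sign_valued g, forall J, ~~ (J \subset S) -> fourier g J = 0 &
   sqnorm2 (fun x => F x - g x) <=
   4 * \sum_(J : {set 'I_n} | ~~ (J \subset S)) fourier F J ^+ 2].
Proof.
move=> sF; pose m := proj (~: S) set0 F.
pose g x : R := if 0 <= m x then 1 else -1.
have disjC J : [disjoint ~: S & J] = (J \subset S).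
  by rewrite disjoint_sym disjoints_subset setCK.
have fm J : fourier m J = if J \subset S then fourier F J else 0.
  by rewrite fourier_proj ?sub0set // disjC set0U.
exists g; split.
- by move=> x; rewrite /g; case: ifP; [right|left].
- move=> J /subsetPn[i iJ iS]; apply: (@expectation_odd _ _ i) => x.
  rewrite chi_flip1 // mulrN; congr (- (_ * _)).
  rewrite /g; suff -> : m (flip [set i] x) = m x by [].
  rewrite (fourier_inversion m) [RHS](fourier_inversion m).
  apply: eq_bigr => K _; rewrite fm; case: ifPn => [sKS|_]; last by rewrite !mul0r.
  rewrite chi_flip_disjoint // disjoints1.
  by apply: contra iS => /(subsetP sKS).
have -> : \sum_(J : {set 'I_n} | ~~ (J \subset S)) fourier F J ^+ 2 =
    sqnorm2 (fun x => F x - m x).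
  rewrite parseval [LHS]big_mkcond; apply: eq_bigr => J _.
  by rewrite fourierB fm; case: (J \subset S); rewrite ?subrr ?subr0 ?expr0n.
(* Where g differs from F, it is at distance 2 from F and m is at distance at
   least 1. *)
rewrite -expectationZ; apply: ler_expectation => x; rewrite /g.
have := sqr_ge0 (1 - m x); have := sqr_ge0 (1 + m x); have := sqr_ge0 (m x).
by case: (lerP 0 (m x)) => mx; case: (sF x) => ->; move: (m x) mx => a; nra.
Qed.

Lemma sum_supersets_fourier I g :
  \sum_(J : {set 'I_n} | I \subset J) fourier g J =
  proj I I g [ffun => false].
Proof.
rewrite [RHS]fourier_inversion.
rewrite (sum_fourier_proj g (w := fun J a => a * chi R J [ffun => false])) //.
  apply: eq_big => J; last by rewrite chi_all_ones mulr1.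
  by rewrite setIC; apply/idP/eqP => /setIidPl.
by move=> J; rewrite mul0r.
Qed.

(** The coefficient of [g] at a subset [J] of [S] is itself a value of an average
    over the coordinates in [S]. *)
Lemma junta_fourier_granular S g J : granular 1 g ->
  (forall K : {set 'I_n}, ~~ (K \subset S) -> fourier g K = 0) ->
  exists z : int, fourier g J = z%:~R * 2 ^- #|S|.
Proof.
move=> gg junta; have [sJS|nsJS] := boolP (J \subset S); last first.
  by exists 0; rewrite junta // mul0r.
have [z ez] := granular_proj S J gg [ffun => false]; exists z; rewrite -ez.
rewrite [RHS]fourier_inversion.
rewrite (sum_fourier_proj g (w := fun J a => a * chi R J [ffun => false])) //.
  rewrite (bigD1 J) /=; last by apply/eqP/setIidPl.
  rewrite chi_all_ones mulr1 big1 ?addr0 // => K /andP[/eqP eJ neq].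
  rewrite junta ?mul0r //; apply: contra neq => /setIidPl.
  by rewrite -eJ => {1}<-.
by move=> K; rewrite mul0r.
Qed.

(** A sum of [2 ^ #|I|] signs differs from [2 ^ #|I|] by an even integer. *)
Lemma proj_sign_granular I g x : sign_valued g ->
  exists z : int, proj I I g x = 1 - z%:~R * 2 * 2 ^- #|I|.
Proof.
move=> sg; rewrite /proj.
suff [z ->] : exists z : int, \sum_(T : {set 'I_n} | T \subset I)
    g (flip T x) * chi R I (flip T x) = 2 ^+ #|I| - z%:~R * 2.
  by exists z; field; rewrite expf_neq0 // pnatr_eq0.
have -> : 2 ^+ #|I| = \sum_(T : {set 'I_n} | T \subset I) 1 :> R.
  rewrite sumr_const -natrX -card_powerset; congr _%:R.
  by apply: eq_card => T; rewrite inE.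
apply: (big_ind2 (fun a b : R => exists z : int, a = b - z%:~R * 2)).
- by exists 0; ring.
- by move=> _ b _ b' [z ->] [z' ->]; exists (z + z'); rewrite rmorphD; ring.
move=> T _.
have [b ->] := chi_sign R I (flip T x).
have [b' ->] : exists b : bool, g (flip T x) = (-1) ^+ b.
  by case: (sg (flip T x)) => ->; [exists true|exists false].
exists (if b' (+) b then 1 else 0); rewrite -signr_addb.
by case: (_ (+) _); rewrite ?expr0 ?expr1; ring.
Qed.

(** The Fourier coefficients of a sign-valued function of degree at most [d]
    are integer multiples of [2 ^ (1 - d)], by downward induction on [I]: the sum
    of the coefficients at the supersets of [I] is such a multiple. *)
Lemma sign_degree_fourier_granular d g I : (0 < d)%N -> sign_valued g ->
  degree_at_most d g -> exists z : int, fourier g I = z%:~R * 2 ^- d.-1.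
Proof.
move=> d0 sg deg; have [k] := ubnP (n - #|I|); elim: k I => // k IHk I lek.
have [ltdI|leId] := ltnP d #|I|; first by exists 0; rewrite deg // mul0r.
have := sum_supersets_fourier I g; rewrite (bigD1 I) //=.
have [z ->] := proj_sign_granular I [ffun => false] sg.
have [z' ->] : exists z' : int,
    \sum_(J : {set 'I_n} | (I \subset J) && (J != I)) fourier g J =
    z'%:~R * 2 ^- d.-1.
  apply: (big_ind (fun a : R => exists z : int, a = z%:~R * 2 ^- d.-1)).
  - by exists 0; rewrite mul0r.
  - by move=> _ _ [a ->] [b ->]; exists (a + b); rewrite rmorphD mulrDl.
  move=> J /andP[sIJ neq]; apply: IHk.
  have : (#|I| < #|J|)%N by rewrite proper_card // properEneq eq_sym neq.
  have : (#|J| <= n)%N by rewrite -[leqRHS]card_ord; apply: max_card.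
  by lia.
move=> eq_sum; have -> : fourier g I =
    1 - z%:~R * 2 * 2 ^- #|I| - z'%:~R * 2 ^- d.-1 by rewrite -eq_sum addrK.
exists ((2 ^ d.-1)%N%:Z - z * (2 ^ (d - #|I|))%N%:Z - z').
rewrite !rmorphB rmorphM /= -!pmulrn !natrX.
have ed : (2 : R) ^+ d.-1 = 2 ^+ (d - #|I|) * 2 ^+ #|I| / 2.
  by rewrite -exprD subnK // -(prednK d0) exprS [2 * _]mulrC mulfK ?pnatr_eq0.
have p0 m : (2 : R) ^+ m != 0 by rewrite expf_neq0 // pnatr_eq0.
have -> : 2 ^- #|I| = 2 ^+ (d - #|I|) / (2 * 2 ^+ d.-1) :> R.
  by rewrite ed; field; rewrite !p0.
by field.
Qed.

End SignValued.

(** * Improving the distance to the junta *)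

Section Bootstrap.
Variables (R : realType) (n : nat).
Implicit Types (F g h : cube n -> R) (I J S U : {set 'I_n}).

(** The coefficient at [U] is the mean of the projection [proj S U h], whose values
    are multiples of [2 ^ (- #|S|)], hence are bounded in absolute value by
    [2 ^ #|S|] times their squares. *)
Lemma fourier_le_slice S U h : granular 1 h -> U \subset S ->
  `|fourier h U| <=
  2 ^+ #|S| * \sum_(J : {set 'I_n} | J :&: S == U) fourier h J ^+ 2.
Proof.
move=> gh sUS; rewrite -(expectation_proj h sUS) -sqnorm2_proj //.
apply: le_trans (ler_norm_expectation _) _.
rewrite -expectationZ; apply: ler_expectation => x.
have p0 : 0 < 2 ^+ #|S| :> R by rewrite exprn_gt0.
rewrite -[_ ^+ 2]real_normK ?num_real //.
have [->|] := granular_gap x (granular_proj S U gh).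
  by rewrite normr0 expr0n mulr0.
rewrite [X in X <= _ -> _]gtr0_norm ?invr_gt0 // => le_p.
by rewrite expr2 mulrA ler_peMl // -ler_pdivrMl // mulr1.
Qed.

(** The squared distance [q] between [F] and [g] is bounded by the coefficients of
    [F - g] at the frequencies [U] of [g], hence by slices of the spectrum of
    [F - g]. Their part of degree above [d] comes from [F] alone, and their part
    of degree at most [d] is of order [q * sqrt q], which is absorbed. *)
Lemma distance_bootstrap (d K l : nat) (W : R) S F g :
  sign_valued F -> sign_valued g -> (#|S| <= K)%N ->
  (forall J, ~~ (J \subset S) -> fourier g J = 0) -> degree_at_most d g ->
  (forall J, (#|J| < l)%N -> fourier g J = 0) ->
  (forall U, (l <= #|U|)%N -> (#|U| <= d)%N ->
     \sum_(J : {set 'I_n} | (U \subset J) && (d < #|J|)%N) fourier F J ^+ 2 <= W) ->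
  0 <= W ->
  sqnorm2 (fun x => F x - g x) <= (4 * 4 ^+ K * 3 ^+ d) ^- 2 ->
  sqnorm2 (fun x => F x - g x) <= 4 * 4 ^+ K * W.
Proof.
move=> sF sg leSK junta deg lowg upF W0; set h := fun x => F x - g x.
set q := sqnorm2 h => small.
have q0 : 0 <= q by apply: sqnorm2_ge0.
have gh : granular 1 h.
  move=> x; have [a ea] := granular_sign sF x; have [b eb] := granular_sign sg x.
  by exists (a - b); rewrite /h ea eb rmorphB mulrBl.
have low : \sum_(J : {set 'I_n} | (#|J| <= d)%N) fourier h J ^+ 2 <=
    3 ^+ d * (q * Num.sqrt q).
  have := low_degree_influence d set0 gh; rewrite cards0 expr0 mul1r.
  have -> : Tinfluence set0 h = q.
    by rewrite /q parseval; apply: eq_bigl => J; rewrite sub0set.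
  by under eq_bigl => J do rewrite sub0set.
set B : R := 2 ^+ K * (W + 3 ^+ d * (q * Num.sqrt q)).
have B0 : 0 <= B.
  by rewrite mulr_ge0 ?exprn_ge0 // addr_ge0 // mulr_ge0 ?exprn_ge0 //
     mulr_ge0 // sqrtr_ge0.
have termB U : `|fourier h U * fourier g U| <= if U \subset S then B else 0.
  have [->|gU] := eqVneq (fourier g U) 0.
    by rewrite mulr0 normr0; case: ifP.
  have sUS : U \subset S by apply: contraNT gU => nsUS; rewrite junta.
  have leUd : (#|U| <= d)%N.
    by rewrite leqNgt; apply: contra gU => ltdU; rewrite deg.
  have lelU : (l <= #|U|)%N.
    by rewrite leqNgt; apply: contra gU => ltUl; rewrite lowg.
  have g1 : `|fourier g U| <= 1.
    have := fourier_sqr_le g U; rewrite sqnorm2_sign //.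
    by rewrite -[_ ^+ 2]real_normK ?num_real // expr_le1.
  rewrite sUS normrM; apply: (@le_trans _ _ `|fourier h U|).
    by rewrite ler_piMr.
  apply: le_trans (fourier_le_slice gh sUS) _.
  apply: ler_pM; first by rewrite exprn_ge0.
  - by apply: sumr_ge0 => J _; apply: sqr_ge0.
  - by rewrite ler_eXn2l // ltr1n.
  apply: le_trans (lerD (upF U lelU leUd) low).
  rewrite [leLHS]big_mkcond [X in X + _]big_mkcond [X in _ + X]big_mkcond.
  rewrite -big_split; apply: ler_sum => J _ /=.
  have [ltdJ|leJd] := ltnP d #|J|.
    rewrite addr0 andbT fourierB deg // subr0.
    case: ifP => [/eqP eU|_]; last by case: ifP => _; rewrite ?sqr_ge0.
    by rewrite -eU subsetIl.
  by rewrite andbF add0r; case: ifP => _; rewrite ?sqr_ge0.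
(* For sign-valued functions, (F - g)^2 = - 2 (F - g) g. *)
have q_eq : q = - 2 * \sum_(J : {set 'I_n}) fourier h J * fourier g J.
  rewrite -plancherel -expectationZ; apply: expectation_ext => x.
  by rewrite /h; case: (sF x) => ->; case: (sg x) => ->; ring.
have le_q : q <= 2 * (2 ^+ K * B).
  apply: (@le_trans _ _ (2 * `|\sum_(J : {set 'I_n}) fourier h J * fourier g J|)).
    rewrite {1}q_eq mulNr -mulrN ler_wpM2l //.
    by apply: le_trans (ler_norm _) _; rewrite normrN.
  rewrite ler_wpM2l //; apply: le_trans (ler_norm_sum _ _ _) _.
  apply: (@le_trans _ _ (\sum_(J : {set 'I_n}) if J \subset S then B else 0)).
    by apply: ler_sum => J _; apply: termB.
  rewrite -big_mkcond sumr_const -[leLHS]mulr_natl ler_wpM2r // -natrX ler_nat.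
  apply: (@leq_trans (2 ^ #|S|)%N); last by rewrite leq_pexp2l.
  by rewrite -card_powerset; apply: subset_leq_card; apply/subsetP => J; rewrite !inE.
have a0 : 0 < 4 * 4 ^+ K * 3 ^+ d :> R.
  by rewrite mulr_gt0 ?exprn_gt0 // mulr_gt0 ?exprn_gt0.
have le_sqrt : Num.sqrt q <= (4 * 4 ^+ K * 3 ^+ d)^-1.
  rewrite -[leRHS]ger0_norm ?invr_ge0 ?(ltW a0) // -sqrtr_sqr ler_wsqrtr //.
  by rewrite exprVn.
have p4 : 2 ^+ K * 2 ^+ K = 4 ^+ K :> R.
  by rewrite -exprMn; congr (_ ^+ _); rewrite -natrM.
have : 2 * (2 ^+ K * B) = 2 * 4 ^+ K * W + 2 * 4 ^+ K * 3 ^+ d * q * Num.sqrt q.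
  by rewrite /B -p4; ring.
have : 2 * 4 ^+ K * 3 ^+ d * q * Num.sqrt q <= q / 2.
  have c0 : 0 <= 2 * 4 ^+ K * 3 ^+ d * q.
    by rewrite mulr_ge0 // mulr_ge0 ?exprn_ge0 // mulr_ge0 ?exprn_ge0.
  apply: le_trans (ler_wpM2l c0 le_sqrt) _.
  rewrite le_eqVlt; apply/orP; left; apply/eqP; field.
  by rewrite !expf_neq0 // pnatr_eq0.
by lra.
Qed.

End Bootstrap.

(** * The theorem *)

Theorem corollary1p8 (R : realType) (d : nat) (hd : (1 <= d)%N) :
  exists C3 C5 : R, 0 < C3 /\ 0 < C5 /\
    forall (n : nat) (f : cube n -> R) (alpha : R) (l : nat),
      (d < n)%N ->
      sign_valued f ->
      0 < alpha -> alpha < C3 ->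
      (forall I : {set 'I_n}, #|I| = d.+1 ->
         Tinfluence I f <= alpha * (ln n%:R / n%:R) ^+ d.+1) ->
      (1 <= l)%N -> (l <= d)%N ->
      (forall I : {set 'I_n}, (#|I| <= l - 1)%N -> `|fourier f I| <= 2 ^- d) ->
      exists g : cube n -> R,
        [/\ sign_valued g,
            degree_at_most d g &
            sqnorm2 (fun x => f x - g x) <= C5 * alpha * (ln n%:R / n%:R) ^+ l].
Proof.
(* K bounds the number of influential coordinates, and C3 is chosen so that all
   squared errors of order alpha are below eps. *)
pose K := (32 * d * 9 ^ d)%N.
pose eps : R := (4 * 4 ^+ K * 3 ^+ d) ^- 2.
have K1 := upper_const_ge1 R d; set k1 := upper_const R d in K1.
have k10 : 0 < k1 by apply: lt_le_trans K1.
pose k3 := junta_const R d.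
have k30 : 0 <= k3.
  rewrite /k3 /junta_const -/k1 addr_ge0 ?(ltW k10) // mulr_ge0 ?sqr_ge0 //.
  by rewrite !mulr_ge0 // exprn_ge0.
have p_gt0 (a : R) m : 0 < a -> 0 < a ^+ m by apply: exprn_gt0.
have eps0 : 0 < eps by rewrite invr_gt0 p_gt0 // !mulr_gt0 ?p_gt0.
have ge1 m (a : R) : 1 <= a -> 1 <= a ^+ m by apply: exprn_ege1.
have D0 : 0 < 2 * k1 + 8 * k3 + 1 by lra.
exists (eps / (2 * k1 + 8 * k3 + 1)), (4 * 4 ^+ K * k1).
split; first by rewrite divr_gt0.
split; first by rewrite mulr_gt0 // mulr_gt0 ?p_gt0.
move=> n f alpha l ltdn sf alpha0; rewrite ltr_pdivlMr // => small inff l1 led lowf.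
have le_eps (a : R) : 0 < a -> a <= 4 * 4 ^+ K * 3 ^+ d -> eps <= a ^- 2.
  move=> a0 lea; rewrite /eps lef_pV2 ?posrE ?p_gt0 ?(lt_le_trans a0) //.
  by rewrite ler_pXn2r ?nnegrE ?(ltW a0) // (le_trans _ lea) ?ltW.
have le4K : 1 <= 4 ^+ K :> R by rewrite ge1 // ler1n.
have le3d : 1 <= 3 ^+ d :> R by rewrite ge1 // ler1n.
have lel4 (a b : R) : 1 <= a -> 1 <= b -> a <= 4 * a * b.
  by clear; move=> a1 b1; nra.
have ler4 (a b : R) : 1 <= a -> 1 <= b -> b <= 4 * a * b.
  by clear; move=> a1 b1; nra.
have ak3 : 0 <= alpha * k3 by rewrite mulr_ge0 // ltW.
have ak1 : 0 <= alpha * k1 by rewrite mulr_ge0 // ltW.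
have eps1 : eps <= 1.
  have := le_eps 1 ltr01; rewrite expr1n invr1; apply.
  exact: le_trans le4K (lel4 _ _ le4K le3d).
have alpha1 : alpha <= 1 by lra.
have gf := granular_sign sf.
have n1 : (1 < n)%N by apply: leq_trans ltdn.
have delta0 := ln_ratio_ge0 R n1; have delta1 := ln_ratio_le1 R n1.
have leK : (#|influential d f| <= K)%N.
  apply: (card_influential hd ltdn gf alpha0 alpha1 inff).
    by rewrite sqnorm2_sign.
  have : eps <= influence_threshold R d.
    apply: le_eps; first by rewrite mulr_gt0 ?p_gt0.
    by rewrite ler_wpM2r ?(le_trans ler01) // ler_peMr.
  by rewrite -/k1; lra.
have off := weight_off_influential hd ltdn gf alpha0 alpha1 inff.
have [g [sg junta dist]] := exists_sign_junta (influential d f) sf.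
set h := fun x => f x - g x in dist.
have {}dist : sqnorm2 h <= 4 * k3 * alpha.
  by apply: le_trans dist _; rewrite -/k3 in off; lra.
have fh J : fourier h J = fourier f J - fourier g J by apply: fourierB.
have up := upper_weight hd ltdn gf alpha0 alpha1 inff.
(* The coefficients of g above degree d are smaller than 2 ^- K, while g depends
   on at most K coordinates. *)
have deg : degree_at_most d g.
  move=> J ltdJ; have [z ez] := junta_fourier_granular J (granular_sign sg) junta.
  have f_small : fourier f J ^+ 2 <= k1 * alpha.
    have := up set0; rewrite cards0 expr0 mulr1 => /(_ isT); apply: le_trans.
    rewrite (bigD1 J) ?sub0set //= lerDl; apply: sumr_ge0 => *; exact: sqr_ge0.
  have h_small := le_trans (fourier_sqr_le h J) dist.
  have g_small : fourier g J ^+ 2 < 2 ^- K ^+ 2.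
    have le_e : eps <= 2 ^- K ^+ 2.
      rewrite exprVn; apply: le_eps; first by rewrite p_gt0.
      apply: (@le_trans _ _ (4 ^+ K)).
        by rewrite lerXn2r ?nnegrE ?ler_nat.
      exact: lel4.
    rewrite fh in h_small; apply: lt_le_trans le_e.
    move: (small) (f_small) (h_small) (alpha0).
    move: (fourier f J) (fourier g J) (eps) (k1) (k3) (alpha) => a b e u v w.
    clear => small ha hb a0.
    have : b ^+ 2 <= 2 * a ^+ 2 + 2 * (a - b) ^+ 2.
      by rewrite -subr_ge0 (_ : _ - _ = (2 * a - b) ^+ 2) ?sqr_ge0 //; ring.
    lra.
  apply/eqP; apply: contraTT g_small => g_neq0; rewrite -leNgt.
  rewrite -[leRHS]real_normK ?num_real // ler_pXn2r ?nnegrE ?invr_ge0 ?exprn_ge0 //.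
  apply: (@le_trans _ _ (2 ^- #|influential d f|)).
    by rewrite lef_pV2 ?posrE ?p_gt0 // ler_eXn2l ?ltr1n.
  have : z != 0 by apply: contraNneq g_neq0 => z0; rewrite ez z0 mul0r.
  rewrite ez normrM => z0; rewrite [X in _ * X]ger0_norm ?invr_ge0 ?exprn_ge0 //.
  rewrite ler_peMl ?invr_ge0 ?exprn_ge0 // -intr_norm (ler_int _ 1).
  by rewrite -gtz0_ge1 normr_gt0.
exists g; split=> //.
rewrite -[leRHS]mulrA -[leRHS]mulrA.
apply: (distance_bootstrap sf sg leK junta deg (l := l)).
(* The coefficients of g below level l are smaller than 2 ^ (1 - d). *)
- move=> J ltJl; have [z ez] := sign_degree_fourier_granular J hd sg deg.
  have leJ : (#|J| <= l - 1)%N by rewrite -ltnS subn1 prednK.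
  have f_small := lowf J leJ.
  have h_small : `|fourier h J| < 2 ^- d.
    rewrite -(@ltr_pXn2r _ 2) ?nnegrE ?invr_ge0 ?exprn_ge0 // real_normK ?num_real //.
    apply: le_lt_trans (le_trans (fourier_sqr_le h J) dist) _.
    have le_e : eps <= 2 ^- d ^+ 2.
      rewrite exprVn; apply: le_eps; first by rewrite p_gt0.
      apply: (@le_trans _ _ (3 ^+ d)).
        by rewrite lerXn2r ?nnegrE ?ler_nat.
      exact: ler4.
    by apply: lt_le_trans le_e; lra.
  have : `|fourier g J| < 2 ^- d.-1.
    have -> : fourier g J = fourier f J - fourier h J by rewrite fh; ring.
    apply: le_lt_trans (ler_normB _ _) _.
    have -> : 2 ^- d.-1 = 2 ^- d + 2 ^- d :> R.
      have -> : 2 ^+ d = 2 * 2 ^+ d.-1 :> R by rewrite -exprS prednK.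
      have : 2 ^+ d.-1 != 0 :> R by rewrite gt_eqF ?p_gt0.
      by move: (2 ^+ d.-1) => u u0; field.
    exact: ler_ltD f_small h_small.
  rewrite ez normrM [X in _ * X]ger0_norm ?invr_ge0 ?exprn_ge0 //.
  have p0 : 0 < 2 ^- d.-1 :> R by rewrite invr_gt0 p_gt0.
  rewrite -ltr_pdivlMr // divff ?gt_eqF // -intr_norm (ltr_int _ _ 1) => ltz.
  have -> : z = 0 by clear -ltz; lia.
  by rewrite mul0r.
- move=> U lelU leUd; apply: le_trans (up U leUd) _.
  rewrite -/k1 -mulrA ler_wpM2l ?(ltW k10) //.
  by rewrite ler_wpM2l ?(ltW alpha0) // ler_wiXn2l.
- by rewrite mulr_ge0 ?(ltW k10) // mulr_ge0 ?(ltW alpha0) // exprn_ge0.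
rewrite -/h -/eps; apply: le_trans dist _; lra.
Qed.
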